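(* Let $S$ be a numerical semigroup with some nonzero $a\in S$, and suppose $\mathrm{Ap}(S;a)\setminus\{0\}$ is an arithmetic sequence consisting of at least one term. Then $a\ge2$ and $$S=\langle\{a\}\cup\{ha+id : 1\le i\le a-1\}\rangle$$ for some integers $h\ge0$ and $d\ge1$ with $\gcd(a,d)=1$. If $h=0$ and $d=1$, then $\mathrm{e}(S)=1$. If $h=0$ and $d>1$, then $\mathrm{e}(S)=2$. If $h\ge1$, then $\mathrm{e}(S)=a$.
   Context: A numerical semigroup is a submonoid $S$ of $(\mathbb{N}_0,+)$ with finite complement. For $G\subset\mathbb{N}_0$, $\langle G\rangle$ is the set of all finite $\mathbb{N}_0$-linear combinations of elements of $G$. The embedding dimension $\mathrm{e}(S)$ is the cardinality of the unique minimal generating set of $S$. For nonzero $a\in S$, the Apéry set is $\mathrm{Ap}(S;a)=\{s\in S: s-a\notin S\}$; it has exactly $a$ elements. ''$\mathrm{Ap}(S;a)\setminus\{0\}$ is an arithmetic sequence'' means that this set equals $\{\beta+\delta,\beta+2\delta,\dots,\beta+(a-1)\delta\}$ for some $\beta\in\mathbb{Z}$ and some positive integer $\delta$. *)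

(* Defs.v *)
From mathcomp Require Export all_boot all_order all_algebra.
From mathcomp Require Export finmap.
From mathcomp Require Export boolp classical_sets functions cardinality.

Set Implicit Arguments.
Unset Strict Implicit.
Unset Printing Implicit Defensive.

Local Open Scope classical_set_scope.
Local Open Scope nat_scope.

Definition numerical_semigroup (S : set nat) : Prop :=
  [/\ S 0, (forall x y, S x -> S y -> S (x + y)) & finite_set (~` S)].

(* A linear combination is a list of pairs (coefficient, generator). *)
Definition generated (G : set nat) : set nat :=
  [set x | exists2 c : seq (nat * nat),
     (forall p, p \in c -> G p.2) & x = \sum_(p <- c) p.1 * p.2].

Definition minimal_generating_set (S G : set nat) : Prop :=
  generated G = S /\ forall H, H `<=` G -> generated H = S -> H = G.

(* A numerical semigroup has exactly one minimal generating set, and it is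
   finite, so neither the default set0 of xget nor the junk value of fset_set
   on infinite sets comes into play. *)
Definition embedding_dim (S : set nat) : nat :=
  #|` fset_set (xget set0 (minimal_generating_set S))|.

(* The subtraction s - a is that of the integers: for s < a the difference is
   negative, hence not in S, whence the guard on the truncated subtraction. *)
Definition Apery (S : set nat) (a : nat) : set nat :=
  [set s | S s /\ ~ (a <= s /\ S (s - a))].

(* The equality is between subsets of int: all terms on the right are required
   to be natural numbers. *)
Definition Apery_arithmetic (S : set nat) (a : nat) : Prop :=
  exists beta delta : int, (0 < delta)%R /\
    [set Posz s | s in Apery S a `\ 0] =
    [set (beta + i%:Z * delta)%R | i in [set i | 1 <= i <= a - 1]].

(* Main.v *)
(* Elements of the Apery set are pairwise incongruent modulo [a], and those
   other than 0 are not divisible by [a].  For [a >= 3] and terms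
   [beta + i * delta] this forces [gcd a delta = 1]; some [i < a] then makes the
   term divisible by [a], and only [i = 0] can, so [beta = h * a].
   Irreducible elements of [S] lie in every generating set, so an irreducible
   generating set is the minimal one.  Irreducibility is read off
   [n * a + t * d = h * a + i * d] with [0 <= i < a], which forces
   [t = i + k * a] and [h = n + k * d] for some [k >= 0]. *)

Require Import Defs.
From mathcomp Require Import zify ring.

Set Implicit Arguments.
Unset Strict Implicit.
Unset Printing Implicit Defensive.

Local Open Scope classical_set_scope.
Local Open Scope nat_scope.

(** * Generated submonoids *)

Lemma generated0 (G : set nat) : generated G 0.
Proof. by exists [::]; rewrite ?big_nil. Qed.

Lemma generatedD (G : set nat) x y :
  generated G x -> generated G y -> generated G (x + y).
Proof.
move=> [c cG ->] [c' c'G ->]; exists (c ++ c'); last by rewrite big_cat.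
by move=> p; rewrite mem_cat => /orP[/cG|/c'G].
Qed.

Lemma generatedM (G : set nat) k g : G g -> generated G (k * g).
Proof.
move=> Gg; exists [:: (k, g)]; last by rewrite big_seq1.
by move=> p; rewrite inE => /eqP ->.
Qed.

Lemma mem_generated (G : set nat) : G `<=` generated G.
Proof. by move=> g Gg; rewrite -(mul1n g); apply: generatedM. Qed.

Lemma generated_sub (G T : set nat) : T 0 ->
  (forall x y, T x -> T y -> T (x + y)) -> G `<=` T -> generated G `<=` T.
Proof.
move=> T0 TD GT _ [c cG ->]; rewrite big_seq.
apply: (big_ind T) => // p /cG/GT Tp.
by elim: p.1 => // k IHk; rewrite mulSn; apply: TD.
Qed.

(** * Irreducible elements and minimal generating sets *)

Definition irreducible_in (S : set nat) (g : nat) : Prop :=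
  g <> 0 /\ forall x y, S x -> S y -> g = x + y -> x = 0 \/ y = 0.

(** The [x] in [generated H] for which [x = g] implies [H g] form a submonoid containing [H]: a sum
    equal to [g] has a zero summand, so the other one is [g]. *)
Lemma irreducible_generator (H : set nat) g :
  irreducible_in (generated H) g -> generated H g -> H g.
Proof.
case=> g0 irr Hg.
have HT : generated H `<=` [set x | generated H x /\ (x = g -> H g)].
  apply: generated_sub => [|x y [Hx xg] [Hy yg]|x Hx] /=.
  - by split=> [|/esym//]; apply: generated0.
  - split=> [|xyg]; first exact: generatedD.
    have [x0|y0] := irr _ _ Hx Hy (esym xyg).
      by apply: yg; rewrite -xyg x0.
    by apply: xg; rewrite -xyg y0 addn0.
  - by split=> [|<-//]; apply: mem_generated.
by have [_] := HT _ Hg; apply.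
Qed.

(** Every generating set contains [G], so [G] is minimal, and the set chosen by [xget], being
    minimal too, equals [G]. *)
Lemma embedding_dim_irreducible (S G : set nat) : generated G = S ->
  (forall g, G g -> irreducible_in S g) ->
  embedding_dim S = #|` fset_set G|.
Proof.
move=> GS irrG.
have sub H : generated H = S -> G `<=` H.
  move=> HS g Gg; apply: irreducible_generator; rewrite HS; first exact: irrG.
  by rewrite -GS; apply: mem_generated.
have minG : minimal_generating_set S G.
  by split=> // H HG HS; apply/seteqP; split=> //; apply: sub.
rewrite /embedding_dim; have := xgetI set0 minG.
set X := xget _ _ => -[XS minX].
by rewrite -(minX G (sub _ XS) GS).
Qed.

Lemma card_fset_set_image (n : nat) (f : nat -> nat) :
  {in `I_n &, injective f} -> #|` fset_set (f @` `I_n)| = n.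
Proof. by move=> /inj_card_eq; apply: card_fset_set. Qed.

(** By coprimality [a] divides the difference of [t] and [i], and [i < a] rules out [t < i]. *)
Lemma coprime_representation (a d n t h i : nat) : coprime a d -> i < a ->
  n * a + t * d = h * a + i * d -> exists k, t = i + k * a /\ h = n + k * d.
Proof.
move=> co_ad lt_ia E.
have [le_it|lt_ti] := leqP i t.
  have E2 : (t - i) * d = (h - n) * a by rewrite !mulnBl; nia.
  have : a %| t - i by rewrite -(Gauss_dvdl _ co_ad) E2 dvdn_mull.
  case/dvdnP=> k tik; exists k.
  have -> : t = i + k * a by lia.
  split=> //; apply/eqP; rewrite -(eqn_pmul2r (leq_ltn_trans _ lt_ia)) //.
  by apply/eqP; nia.
have E2 : (i - t) * d = (n - h) * a by rewrite !mulnBl; nia.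
have : a %| i - t by rewrite -(Gauss_dvdl _ co_ad) E2 dvdn_mull.
by move/dvdn_leq; lia.
Qed.

(** * Embedding dimension for arithmetic generators *)

Section ArithmeticGenerators.
Variables a h d : nat.
Hypotheses (a_gt1 : 1 < a) (d_gt0 : 0 < d) (co_ad : coprime a d).

Let gens := [set a] `|` [set h * a + i * d | i in [set i | 1 <= i <= a - 1]].

(** Each generator [h * a + i * d] brings [h] copies of [a]; this bound on [n] is what yields
    irreducibility when [h > 0]. *)
Lemma generated_arithmetic_form s : generated gens s ->
  exists n t, s = n * a + t * d /\ (t = 0 \/ h <= n).
Proof.
apply: (@generated_sub _
  [set s | exists n t, s = n * a + t * d /\ (t = 0 \/ h <= n)])
  => {s} [|x y [n [t [-> nt]]] [m [u [-> mu]]]|x] /=.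
- by exists 0, 0; split=> //; left.
- by exists (n + m), (t + u); split; [nia|lia].
- case=> [->|[i _ <-]]; first by exists 1, 0; split; [lia|left].
  by exists h, i; split=> //; right.
Qed.

Lemma embedding_dim_arithmetic : 0 < h -> embedding_dim (generated gens) = a.
Proof.
move=> h_gt0; rewrite (embedding_dim_irreducible erefl); last first.
  move=> g Gg; split; first by case: Gg => [->|[i /= ? <-]]; nia.
  move=> x y /generated_arithmetic_form[n [t [-> nt]]].
  move=> /generated_arithmetic_form[m [u [-> mu]]].
  rewrite addnACA -!mulnDl.
  case: Gg => [->|[i /= ia <-]] E.
    have [//||k [tu nm]] := @coprime_representation a d (n + m) (t + u) 1 0 co_ad.
    - by lia.
    - by rewrite -E; ring.
    (* If [k > 0], then [n + m = 0] while [t] or [u] is positive, forcing [h = 0]. *)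
    have k0 : k = 0 by nia.
    by subst k; have [n0|m0] : n = 0 \/ m = 0; [lia|left|right]; nia.
  have [|k [tu nm]] := coprime_representation co_ad _ (esym E); first by lia.
  (* As [i >= 1], one of [t], [u] is positive, say [u]. Then [h <= m], so [n + m + k * d = h] gives
     [n = 0], and [t > 0] would give [h <= 0]. *)
  have k0 : t = 0 /\ n = 0 \/ u = 0 /\ m = 0 by nia.
  by case: k0 => -[-> ->]; [left|right].
(* Index 0 encodes the generator [a]; all others exceed it because [h > 0]. *)
pose f i := if i == 0 then a else h * a + i * d.
have -> : gens = f @` `I_a.
  apply/seteqP; split=> x.
    case=> [->|[i /= ia <-]]; first by exists 0 => //=; lia.
    by exists i; rewrite /f /=; [lia|case: eqP => //; lia].
  case=> -[|i] /= ia <-; first by left.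
  by right; exists i.+1 => //=; lia.
apply: card_fset_set_image => -[|i] [|j] _ _; rewrite /f /=; nia.
Qed.

(** For [h = 0] the generators other than [a] are multiples of [d], and [d] is among them.
    Irreducibility of [a] rests on [1 < d], that of [d] on [1 < a]. *)
Lemma embedding_dim_two : h = 0 -> 1 < d -> embedding_dim (generated gens) = 2.
Proof.
move=> h0 d_gt1; rewrite (@embedding_dim_irreducible _ [set a; d]).
- have -> : [set a; d] = (fun i => if i == 0 then a else d) @` `I_2.
    apply/seteqP; split=> x; first by case=> ->; [exists 0|exists 1].
    by case=> -[|[|//]] _ <-; [left|right].
  have ad : a <> d by move=> ad; move: co_ad; rewrite ad /coprime gcdnn; lia.
  apply: card_fset_set_image => -[|[|i]] [|[|j]]; rewrite ?in_setE //=; lia.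
- apply/seteqP; split.
    apply: generated_sub; [exact: generated0|exact: generatedD|].
    move=> _ [->|->]; apply: mem_generated; [by left|right].
    by exists 1; [rewrite /=; lia|rewrite h0; ring].
  apply: generated_sub; [exact: generated0|exact: generatedD|].
  move=> _ [->|[i _ <-]]; first by apply: mem_generated; left.
  by rewrite h0; apply: generatedM; right.
move=> g Gg; split; first by case: Gg => ->; lia.
move=> x y /generated_arithmetic_form[n [t [-> _]]].
move=> /generated_arithmetic_form[m [u [-> _]]].
rewrite addnACA -!mulnDl.
case: Gg => -> E.
  have [//||k [tu nm]] := @coprime_representation a d (n + m) (t + u) 1 0 co_ad.
  - by lia.
  - by rewrite -E; ring.
  have k0 : k = 0 by nia.
  by subst k; have [n0|m0] : n = 0 \/ m = 0; [lia|left|right]; nia.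
have [//||k [tu nm]] := @coprime_representation a d (n + m) (t + u) 0 1 co_ad.
- by rewrite -E; ring.
have k0 : k = 0 by nia.
by subst k; have [n0|m0] : t = 0 \/ u = 0; [lia|left|right]; nia.
Qed.

Lemma embedding_dim_one : h = 0 -> d = 1 -> embedding_dim (generated gens) = 1.
Proof.
move=> h0 d1; rewrite (@embedding_dim_irreducible _ [set 1]).
- by rewrite fset_set1 cardfs1.
- apply/seteqP; split=> x _; last by rewrite -(muln1 x); apply: generatedM.
  rewrite -(muln1 x); apply: generatedM; right.
  by exists 1; [rewrite /=; lia|rewrite h0 d1].
by move=> _ ->; split=> // x y _ _; lia.
Qed.

End ArithmeticGenerators.

(** * Apéry sets *)

Section Apery.
Variables (S : set nat) (a : nat).
Hypotheses (S0 : S 0) (SD : forall x y, S x -> S y -> S (x + y)) (Sa : S a).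
Hypothesis a_gt0 : 0 < a.

(** Otherwise [w - a = v + k * a] would lie in [S]. *)
Lemma Apery_not_shift v w k : Apery S a w -> S v -> w <> v + k.+1 * a.
Proof.
move=> [_ nSw] Sv E; apply: nSw; split; first by nia.
have -> : w - a = v + k * a by nia.
by apply: SD => //; elim: k {E} => // k; rewrite mulSn; apply: SD.
Qed.

Lemma Apery_eq_mod v w :
  Apery S a v -> Apery S a w -> v = w %[mod a] -> v = w.
Proof.
wlog le_vw : v w / v <= w.
  by move=> W Av Aw E; case: (leqP v w) => [|/ltnW] le; [|symmetry]; apply: W.
move=> Av Aw /esym/eqP; rewrite eqn_mod_dvd // => /dvdnP[[|k] E]; first by lia.
by case: (@Apery_not_shift v w k Aw Av.1); lia.
Qed.

Lemma Apery_not_dvd w : (Apery S a `\ 0) w -> ~ a %| w.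
Proof.
move=> [Aw /= w0] /dvdnP[[|k] E]; first by apply: w0; rewrite E.
by apply: (Apery_not_shift (k := k) Aw S0).
Qed.

(** Subtracting [a] as long as the result stays in [S] ends in the Apéry set. *)
Lemma generated_Apery (G : set nat) : G a -> G `<=` S ->
  Apery S a `\ 0 `<=` generated G -> S = generated G.
Proof.
move=> Ga GS AG; apply/seteqP; split; last exact: generated_sub.
move=> s; have [n] := ubnP s; elim: n s => // n IHn s lt_sn Ss.
have [[le_as Ssa]|nS] := pselect (a <= s /\ S (s - a)).
  rewrite -(subnK le_as); apply: generatedD; last exact: mem_generated.
  by apply: IHn => //; lia.
have [->|s0] := pselect (s = 0); first exact: generated0.
by apply: AG.
Qed.

Lemma Apery_arithmetic_parameters (beta : int) (d : nat) : 2 < a -> 0 < d ->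
  (forall i, 1 <= i <= a - 1 -> exists2 w, (Apery S a `\ 0) w &
     Posz w = (beta + i%:Z * d%:Z)%R) ->
  coprime a d /\ exists h, beta = Posz (h * a).
Proof.
move=> a_gt2 d_gt0 Aw.
have not_dvd i j : 1 <= i <= a - 1 -> 1 <= j <= a - 1 -> i < j ->
    ~ (a %| (j - i) * d).
  move=> ia ja ij; have [v [Av _] vE] := Aw _ ia; have [w [A_w _] wE] := Aw _ ja.
  have -> : (j - i) * d = w - v by nia.
  have lt_vw : v < w by nia.
  move=> dv; have : w = v; last by lia.
  apply: (Apery_eq_mod A_w Av); apply/eqP; rewrite eqn_mod_dvd //; exact: ltnW.
have co_ad : coprime a d.
  have /dvdnP[a' a'E] := dvdn_gcdl a d; have /dvdnP[d' d'E] := dvdn_gcdr a d.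
  (* The terms of index 1 and [1 + a'] differ by [a' * d = d' * a]. If the gcd exceeds 1, then
     [1 + a' <= a - 1] because [a > 2]. *)
  have := @not_dvd 1 (1 + a'); rewrite /coprime.
  move: (gcdn a d) a'E d'E => g a'E d'E nd.
  apply/eqP/not_notP => g1; apply: nd; [by lia|by nia|by nia|].
  by apply/dvdnP; exists d'; rewrite a'E d'E; nia.
split=> //.
have [|w1 Aw1 w1E] := Aw 1; first by lia.
have a_dvd : exists2 k, k < a & a %| w1 + k * d.
  (* [x] is a multiple of [d] congruent to [- w1] modulo [a]. *)
  pose x := chinese a d (a - w1 %% a) 0.
  have /dvdnP[m xE] : d %| x by rewrite /dvdn (chinese_modr co_ad) mod0n.
  exists (m %% a); first by rewrite ltn_mod.
  rewrite /dvdn -modnDmr modnMml -xE modnDmr -modnDmr (chinese_modl co_ad).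
  by rewrite modnDmr -modnDml subnKC ?modnn // ltnW // ltn_mod.
have a_dvd_beta : exists q : int, beta = (q * a%:Z)%R.
  have [k lt_ka /dvdnP[q qE]] := a_dvd.
  (* [w1 + k * d] is the term of index [k + 1], which cannot be divisible by [a]. So [k = a - 1],
     and [beta + a * d = q * a]. *)
  have [lt_k|le_k] := ltnP k (a - 1).
    have [|w Aw' wE] := Aw k.+1; first by lia.
    by case: (Apery_not_dvd Aw'); apply/dvdnP; exists q; nia.
  by exists (q%:Z - d%:Z)%R; nia.
have [[q|q] E] := a_dvd_beta; first by exists q; lia.
(* For a negative [beta], the term with index 2 exceeds twice the first term
   by a positive multiple of [a]. *)
have [|w2 [Aw2 _] w2E] := Aw 2; first by lia.
have := @Apery_not_shift (w1 + w1) w2 q Aw2 (SD Aw1.1.1 Aw1.1.1).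
by rewrite NegzE in E; case; nia.
Qed.

Lemma Apery_arithmetic_generated : 1 < a -> Apery_arithmetic S a ->
  exists h d, [/\ 1 <= d, gcdn a d = 1 & S = generated ([set a] `|`
    [set h * a + i * d | i in [set i | 1 <= i <= a - 1]])].
Proof.
move=> a_gt1 [beta [delta [delta_gt0 /seteqP[ApE EAp]]]].
have Aw i : 1 <= i <= a - 1 -> exists2 w, (Apery S a `\ 0) w &
    Posz w = (beta + i%:Z * delta)%R.
  by move=> ia; apply: EAp; exists i.
(* The nonzero Apéry elements are then the generators other than [a], so [generated_Apery]
   applies. *)
suff [h [d [d_gt0 co_ad hd]]] : exists h d, [/\ 0 < d, coprime a d &
    forall i, 1 <= i <= a - 1 ->
      (beta + i%:Z * delta)%R = Posz (h * a + i * d)].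
  exists h, d; split=> //; first exact/eqP.
  apply: generated_Apery; first by left.
    move=> _ [->//|[i /= ia <-]]; have [w [[Sw _] _]] := Aw i ia.
    by rewrite hd // => -[<-].
  move=> w Aw'; have [|i /= ia wE] := ApE (Posz w); first by exists w.
  apply: mem_generated; right; exists i => //.
  by move: wE; rewrite hd // => -[].
have [a_le2|a_gt2] := leqP a 2.
  (* A single term says nothing about [delta]. *)
  have a2 : a = 2 by lia.
  have [|w Aw' wE] := Aw 1; first by lia.
  (* The only generator besides [a] is then [w] itself, which is odd. *)
  exists 0, w; split.
  - by rewrite lt0n; apply/eqP => w0; apply: Aw'.2.
  - have := Apery_not_dvd Aw'; rewrite a2 dvdn2 coprime2n => /negP.
    by rewrite negbK.
  - by move=> i ia; have -> : i = 1 by [lia]; rewrite -wE; lia.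
case: delta delta_gt0 {ApE EAp} Aw => // d d_gt0 Aw.
have [co_ad [h betaE]] := Apery_arithmetic_parameters a_gt2 d_gt0 Aw.
by exists h, d; split=> // i _; rewrite betaE; lia.
Qed.

End Apery.

Theorem proposition5p5 (S : set nat) (a : nat)
  (S_numerical : numerical_semigroup S) (Sa : S a) (a_neq0 : a <> 0)
  (Ap_arith : Apery_arithmetic S a) (Ap_nonempty : Apery S a `\ 0 !=set0) :
  let represents (h d : nat) :=
    [/\ 1 <= d, gcdn a d = 1 &
      S = generated ([set a] `|`
            [set h * a + i * d | i in [set i | 1 <= i <= a - 1]])] in
  [/\ 2 <= a,
      exists h d, represents h d &
      forall h d, represents h d ->
        [/\ h = 0 -> d = 1 -> embedding_dim S = 1,
            h = 0 -> 1 < d -> embedding_dim S = 2 &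
            1 <= h -> embedding_dim S = a]].
Proof.
case: S_numerical => S0 SD _ represents.
have a_gt0 : 0 < a by lia.
have a_gt1 : 1 < a.
  have [w Aw] := Ap_nonempty; have [beta [delta [_ ApE]]] := Ap_arith.
  have : [set Posz s | s in Apery S a `\ 0] (Posz w) by exists w.
  by rewrite ApE => -[i /= ia _]; lia.
split=> //; first exact: Apery_arithmetic_generated.
move=> h d [d_gt0 /eqP co_ad ->]; split.
- exact: embedding_dim_one.
- exact: embedding_dim_two.
- exact: embedding_dim_arithmetic.
Qed.
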